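(* For every finite, simple, connected, undirected graph $G$, the box complex $B_0(G)$ is $\mathbb{Z}_2$-homotopy equivalent to the suspension $\mathrm{susp}(B(G))$ of the box complex $B(G)$.
   Context: Let $G$ be a graph with vertex set $V(G)$ and edge set $E(G)$. For $A\subseteq V(G)$ put $\mathrm{CN}(A)=\{v\in V(G): \{a,v\}\in E(G)\text{ for all }a\in A\}$ (so $\mathrm{CN}(\emptyset)=V(G)$). For disjoint $A,B\subseteq V(G)$, $G[A,B]$ is the graph with vertex set $A\cup B$ and edges $\{a,b\}\in E(G)$ with $a\in A$, $b\in B$; it is called complete bipartite if every $a\in A$ is adjacent to every $b\in B$ (vacuously true if $A$ or $B$ is empty). For sets $A,B$ write $A\uplus B=\{(a,0):a\in A\}\cup\{(b,1):b\in B\}$. The box complexes are the simplicial complexes $B(G)=\{A\uplus B: A,B\subseteq V(G),\ A\cap B=\emptyset,\ G[A,B]\text{ complete bipartite},\ \mathrm{CN}(A)\neq\emptyset\neq\mathrm{CN}(B)\}$ and $B_0(G)=\{A\uplus B: A,B\subseteq V(G),\ A\cap B=\emptyset,\ G[A,B]\text{ complete bipartite}\}$, both with the free $\mathbb{Z}_2$-action $A\uplus B\mapsto B\uplus A$. Complexes are identified with their geometric realizations. A $\mathbb{Z}_2$-space is a pair $(X,\nu)$ with $\nu:X\to X$ a homeomorphism with $\nu^2=\mathrm{id}$; a $\mathbb{Z}_2$-map is a continuous map commuting with the involutions. The suspension $\mathrm{susp}(X)$ is the join of $X$ with two points $x,y$ (the apexes), with the involution that acts as $\nu$ on $X$ and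 interchanges the two apexes ($\mathrm{susp}(\emptyset)=S^0$). A $\mathbb{Z}_2$-homotopy equivalence is a $\mathbb{Z}_2$-map $f:X\to Y$ for which there is a $\mathbb{Z}_2$-map $g:Y\to X$ such that $g\circ f$ and $f\circ g$ are homotopic, through $\mathbb{Z}_2$-maps, to $\mathrm{id}_X$ and $\mathrm{id}_Y$. *)

(* Defs.v *)
From HB Require Import structures.
From mathcomp Require Import all_boot all_order all_algebra generic_quotient.
From mathcomp Require Import all_classical all_reals.
From mathcomp Require Import topology normedtype.

Set Implicit Arguments.
Unset Strict Implicit.
Unset Printing Implicit Defensive.
Import Order.TTheory GRing.Theory Num.Theory.
Import numFieldNormedType.Exports.

Local Open Scope classical_set_scope.
Local Open Scope ring_scope.
Local Open Scope quotient_scope.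

Definition unitI (R : realType) : topologicalType :=
  set_type (`[0, 1]%classic : set R).

Lemma zero_in_unitI (R : realType) : (0 : R) \in (`[0, 1]%classic : set R).
Proof. by apply/mem_set; rewrite /= in_itv /= lexx ler01. Qed.

Lemma one_in_unitI (R : realType) : (1 : R) \in (`[0, 1]%classic : set R).
Proof. by apply/mem_set; rewrite /= in_itv /= lexx ler01. Qed.

Definition I0 (R : realType) : unitI R := exist _ 0 (zero_in_unitI R).
Definition I1 (R : realType) : unitI R := exist _ 1 (one_in_unitI R).

(* A continuous involution is its own continuous inverse, so [Z2_nu] is a
   homeomorphism.  The carrier may be empty. *)
Record Z2space := MkZ2space {
  Z2_carrier :> topologicalType;
  Z2_nu : Z2_carrier -> Z2_carrier;
  Z2_nu_continuous : continuous Z2_nu;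
  Z2_nuK : involutive Z2_nu
}.

Definition Z2map (X Y : Z2space) (f : X -> Y) : Prop :=
  continuous f /\ forall x, f (Z2_nu x) = Z2_nu (f x).

Definition Z2homotopic (R : realType) (X Y : Z2space) (f g : X -> Y) : Prop :=
  exists H : (X * unitI R)%type -> Y,
    [/\ continuous H,
        forall t : unitI R, Z2map (fun x : X => H (x, t)),
        forall x : X, H (x, I0 R) = f x
      & forall x : X, H (x, I1 R) = g x].

Definition Z2homotopy_equivalence (R : realType) (X Y : Z2space) (f : X -> Y) :
    Prop :=
  Z2map f /\
  exists g : Y -> X,
    [/\ Z2map g,
        Z2homotopic R (g \o f) (fun x : X => x)
      & Z2homotopic R (f \o g) (fun y : Y => y)].

Definition Z2homotopy_equivalent (R : realType) (X Y : Z2space) : Prop :=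
  exists f : X -> Y, Z2homotopy_equivalence R f.

(* The join of [X] and [Y] is the quotient of the disjoint union of [X], [Y]
   and [X * Y * [0, 1]] in which [(x, y, 0)] is glued to [x] and [(x, y, 1)] is
   glued to [y].  Keeping [X] and [Y] as summands gives the usual convention
   that the join of the empty space with [Y] is [Y]. *)
Section Join.
Variable R : realType.

Section Space.
Variables X Y : topologicalType.

Definition join_part (i : option bool) : topologicalType :=
  match i with
  | Some false => X
  | Some true => Y
  | None => (X * Y * unitI R)%type
  end.

Definition prejoin : topologicalType := {i : option bool & join_part i}.

Definition in_left (x : X) : prejoin := existT join_part (Some false) x.
Definition in_right (y : Y) : prejoin := existT join_part (Some true) y.
Definition in_mid (p : X * Y * unitI R) : prejoin := existT join_part None p.

(* Canonical representative of the class of a point: two points of the disjoint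
   union are glued together iff they have the same canonical representative. *)
Definition join_nf (z : prejoin) : prejoin :=
  match z with
  | existT None p =>
      if p.2 == I0 R then in_left p.1.1
      else if p.2 == I1 R then in_right p.1.2
      else z
  | _ => z
  end.

Definition join_eq (z z' : prejoin) : bool := join_nf z == join_nf z'.

Lemma join_eq_refl : reflexive join_eq.
Proof. by move=> z; rewrite /join_eq. Qed.

Lemma join_eq_sym : symmetric join_eq.
Proof. by move=> z z'; rewrite /join_eq eq_sym. Qed.

Lemma join_eq_trans : transitive join_eq.
Proof. by move=> y x z; rewrite /join_eq => /eqP ->. Qed.

Canonical join_equiv : equiv_rel prejoin :=
  EquivRel join_eq join_eq_refl join_eq_sym join_eq_trans.

Definition join : topologicalType := quotient_topology {eq_quot join_equiv}.

Definition join_pi (z : prejoin) : join :=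
  \pi_(quotient_topology {eq_quot join_equiv}) z.

End Space.

Definition prejoin_map (X X' Y Y' : topologicalType)
    (f : X -> X') (g : Y -> Y') (z : prejoin X Y) : prejoin X' Y' :=
  match z with
  | existT (Some false) x => in_left Y' (f x)
  | existT (Some true) y => in_right X' (g y)
  | existT None p => in_mid (f p.1.1, g p.1.2, p.2)
  end.

Definition join_map (X X' Y Y' : topologicalType)
    (f : X -> X') (g : Y -> Y') (z : join X Y) : join X' Y' :=
  join_pi (prejoin_map f g (repr z)).

Lemma join_piP (X Y : topologicalType) (z z' : prejoin X Y) :
  reflect (join_pi z = join_pi z') (join_nf z == join_nf z').
Proof. exact: (@eqmodP _ (join_equiv X Y) z z'). Qed.

Lemma join_pi_repr (X Y : topologicalType) (z : join X Y) :
  join_pi (repr z) = z.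
Proof. exact: reprK. Qed.

Lemma join_nfK (X Y : topologicalType) (z : prejoin X Y) :
  join_pi (join_nf z) = join_pi z.
Proof.
apply/join_piP; case: z => [[[]|] p] //=.
by case: (p.2 =P I0 R) => [_|/eqP/negbTE h0] //=;
   case: (p.2 =P I1 R) => [_|/eqP/negbTE h1] //=; rewrite h0 h1.
Qed.

Lemma join_nf_map (X X' Y Y' : topologicalType) (f : X -> X') (g : Y -> Y')
    (z : prejoin X Y) :
  join_nf (prejoin_map f g (join_nf z)) = join_nf (prejoin_map f g z).
Proof.
case: z => [[[]|] p] //=.
case: (p.2 =P I0 R) => [h|/eqP/negbTE h0] //=.
case: (p.2 =P I1 R) => [h|/eqP/negbTE h1] //=.
by rewrite h0 h1.
Qed.

Lemma join_map_pi (X X' Y Y' : topologicalType) (f : X -> X') (g : Y -> Y')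
    (z : prejoin X Y) :
  join_map f g (join_pi z) = join_pi (prejoin_map f g z).
Proof.
apply/join_piP; rewrite -join_nf_map.
have /join_piP/eqP -> := join_pi_repr (join_pi z).
by rewrite join_nf_map.
Qed.

Lemma prejoin_map_continuous (X X' Y Y' : topologicalType)
    (f : X -> X') (g : Y -> Y') :
  continuous f -> continuous g -> continuous (prejoin_map f g).
Proof.
move=> cf cg.
have cl : continuous (@in_left X' Y' \o f).
  move=> x; apply: continuous_comp; first exact: cf.
  exact: (@existT_continuous _ (join_part X' Y') (Some false)).
have cr : continuous (@in_right X' Y' \o g).
  move=> y; apply: continuous_comp; first exact: cg.
  exact: (@existT_continuous _ (join_part X' Y') (Some true)).
have cp : continuous (fun p : X * Y * unitI R => (f p.1.1, g p.1.2, p.2)).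
  move=> p.
  have c1 : (fun p : X * Y * unitI R => f p.1.1) @ p --> f p.1.1.
    apply: (@continuous_comp _ _ _ (fst \o fst) f); last exact: cf.
    by apply: (@continuous_comp _ _ _ fst fst); exact: cvg_fst.
  have c2 : (fun p : X * Y * unitI R => g p.1.2) @ p --> g p.1.2.
    apply: (@continuous_comp _ _ _ (snd \o fst) g); last exact: cg.
    by apply: (@continuous_comp _ _ _ fst snd); [exact: cvg_fst|exact: cvg_snd].
  have c3 : (fun p : X * Y * unitI R => p.2) @ p --> p.2 by exact: cvg_snd.
  exact: (cvg_pair (cvg_pair c1 c2) c3).
have cm : continuous (@in_mid X' Y' \o
    (fun p : X * Y * unitI R => (f p.1.1, g p.1.2, p.2))).
  move=> p; apply: continuous_comp; first exact: cp.
  exact: (@existT_continuous _ (join_part X' Y') None).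
by move=> [[[]|] p] U nU; [exact: cr|exact: cl|exact: cm].
Qed.

Lemma join_map_continuous (X X' Y Y' : topologicalType)
    (f : X -> X') (g : Y -> Y') :
  continuous f -> continuous g -> continuous (join_map f g).
Proof.
move=> cf cg; apply/(@quotient_continuous _ {eq_quot join_equiv X Y}).
have -> : join_map f g \o \pi_(quotient_topology {eq_quot join_equiv X Y}) =
    @join_pi X' Y' \o prejoin_map f g.
  by apply/funext => z; exact: join_map_pi.
move=> z; apply: continuous_comp; first exact: prejoin_map_continuous.
exact: pi_continuous.
Qed.

Lemma join_mapK (X Y : topologicalType) (f : X -> X) (g : Y -> Y) :
  involutive f -> involutive g -> involutive (join_map f g).
Proof.
move=> fK gK z; rewrite -[z]join_pi_repr !join_map_pi; congr join_pi.
by case: (repr z) => [[[]|] p] /=; rewrite /in_left /in_right /in_mid /= ?fK ?gK //;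
  case: p => [[]].
Qed.

(* The involution acts diagonally: [(x, y, t)] goes to [(nu x, nu y, t)]. *)
Definition Z2join (X Y : Z2space) : Z2space :=
  MkZ2space
    (join_map_continuous (@Z2_nu_continuous X) (@Z2_nu_continuous Y))
    (join_mapK (@Z2_nuK X) (@Z2_nuK Y)).

End Join.

Lemma negb_continuous : continuous negb.
Proof.
by apply/continuousP => A _; exact: discrete_open.
Qed.

(* The two apexes, as a discrete space, interchanged by the involution. *)
Definition Z2S0 : Z2space := MkZ2space negb_continuous negbK.

Definition susp (R : realType) (X : Z2space) : Z2space := Z2join R X Z2S0.

(* Finite abstract simplicial complexes, containing the empty face when
   nonempty; elements of [T] need not all be vertices of the complex. *)
Record complex (T : finType) := MkComplex {
  faces : {set {set T}};
  faces_down : forall s t : {set T}, s \in faces -> t \subset s -> t \in faces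
}.

Record Z2complex (T : finType) := MkZ2complex {
  Z2_complex :> complex T;
  Z2_swap : T -> T;
  Z2_swapK : involutive Z2_swap;
  Z2_swap_faces : forall s : {set T},
    s \in faces Z2_complex -> Z2_swap @: s \in faces Z2_complex
}.

Section Realization.
Variables (R : realType) (T : finType).

(* Barycentric coordinates of the points of the geometric realization, inside
   R^T with its product topology. *)
Definition realization_set (K : complex T) : set {ptws T -> R} :=
  [set x | [/\ forall v : T, 0 <= x v,
               \sum_(v : T) x v = 1
             & [set v : T | x v != 0]%SET \in faces K]].

Definition realization (K : complex T) : topologicalType :=
  set_type (realization_set K).

Variable K : Z2complex T.

Lemma realization_nu_subproof (x : realization K) :
  (fun v => \val x (Z2_swap K v)) \in realization_set K.
Proof.
case: x => x /= /set_mem [x0 x1 xK]; apply/mem_set; split => //=.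
- by rewrite -x1 [RHS](reindex_inj (inv_inj (@Z2_swapK _ K))).
- suff -> : [set v : T | x (Z2_swap K v) != 0]%SET =
      Z2_swap K @: [set v : T | x v != 0]%SET by exact: Z2_swap_faces.
  apply/setP => v; have inj := inv_inj (@Z2_swapK _ K).
  by rewrite -[v in RHS](@Z2_swapK _ K) mem_imset // !inE.
Qed.

(* The linear extension of the vertex involution: the coordinate of the image
   at [v] is the coordinate of [x] at the preimage of [v]. *)
Definition realization_nu (x : realization K) : realization K :=
  exist _ (fun v => \val x (Z2_swap K v)) (realization_nu_subproof x).

Lemma realization_nu_continuous : continuous realization_nu.
Proof.
have ev (v : T) : continuous (fun x : realization K => \val x v).
  move=> x; apply: (@continuous_comp _ _ _
    (\val : realization K -> {ptws T -> R}) (fun z => z v)).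
    exact: initial_continuous.
  exact: (@proj_continuous T (fun _ => R) v).
apply: continuous_comp_initial => x.
have Ff : Filter ((\val \o realization_nu) @ x).
  exact: (@fmap_filter _ _ _ _ (nbhs_filter x)).
apply/(@cvg_sup _ _ _ _ _ Ff) => v; apply/(@cvg_image _ _ _ _ _ Ff).
  by rewrite -subTset => r _; exists (fun=> r).
move=> U /(ev (Z2_swap K v)) nU.
exists [set z : T -> R | U (z v)]; first exact: nU.
by rewrite eqEsubset; split => [r [z Uz <-]//|r Ur]; exists (fun=> r).
Qed.

Lemma realization_nuK : involutive realization_nu.
Proof.
by move=> x; apply/val_inj/funext => v /=; rewrite Z2_swapK.
Qed.

Definition Z2realization : Z2space :=
  MkZ2space realization_nu_continuous realization_nuK.

End Realization.

(* A graph on [V] is given by its adjacency relation; connected graphs are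
   nonempty. *)
Definition connected_graph (V : finType) (E : rel V) : Prop :=
  (0 < #|V|)%N /\ forall u v : V, connect E u v.

Section BoxComplexes.
Variables (V : finType) (E : rel V).
Implicit Types A B : {set V}.

Definition CN A : {set V} := [set v | [forall a in A, E a v]].

Definition complete_bipartite A B : bool :=
  [forall a in A, forall b in B, E a b].

Definition uplus A B : {set V * bool} :=
  [set (a, false) | a in A] :|: [set (b, true) | b in B].

Definition B0_faces : {set {set V * bool}} :=
  [set uplus P.1 P.2 | P : {set V} * {set V}
     & [disjoint P.1 & P.2] && complete_bipartite P.1 P.2].

Definition B_faces : {set {set V * bool}} :=
  [set uplus P.1 P.2 | P : {set V} * {set V}
     & [&& [disjoint P.1 & P.2], complete_bipartite P.1 P.2,
           CN P.1 != finset.set0 & CN P.2 != finset.set0]].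

Definition part (b : bool) (s : {set V * bool}) : {set V} :=
  [set v | (v, b) \in s].

Lemma in_uplus A B (v : V) (b : bool) :
  ((v, b) \in uplus A B) = (v \in if b then B else A).
Proof.
rewrite inE; apply/orP/idP => [[/imsetP[w wA [-> ->]]|/imsetP[w wB [-> ->]]]//|].
by case: b => vAB; [right|left]; apply/imsetP; exists v.
Qed.

Lemma uplus_part (s : {set V * bool}) : uplus (part false s) (part true s) = s.
Proof. by apply/setP => -[v []]; rewrite in_uplus inE. Qed.

Lemma part_uplus (b : bool) A B : part b (uplus A B) = if b then B else A.
Proof. by apply/setP => v; rewrite inE in_uplus. Qed.

Lemma part_sub (b : bool) (s t : {set V * bool}) :
  s \subset t -> part b s \subset part b t.
Proof.
by move=> /fintype.subsetP st; apply/fintype.subsetP => v; rewrite !inE; exact: st.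
Qed.

Lemma B0_facesP (s : {set V * bool}) :
  (s \in B0_faces) =
  [disjoint part false s & part true s] &&
    complete_bipartite (part false s) (part true s).
Proof.
apply/imsetP/idP => [[[A B]]|h].
  by rewrite inE /= => h ->; rewrite !part_uplus.
by exists (part false s, part true s); rewrite ?inE //= uplus_part.
Qed.

Lemma B_facesP (s : {set V * bool}) :
  (s \in B_faces) =
  [&& [disjoint part false s & part true s],
      complete_bipartite (part false s) (part true s),
      CN (part false s) != finset.set0 & CN (part true s) != finset.set0].
Proof.
apply/imsetP/idP => [[[A B]]|h].
  by rewrite inE /= => h ->; rewrite !part_uplus.
by exists (part false s, part true s); rewrite ?inE //= uplus_part.
Qed.

Lemma complete_bipartiteS A B A' B' :
  A' \subset A -> B' \subset B ->
  complete_bipartite A B -> complete_bipartite A' B'.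
Proof.
move=> /fintype.subsetP sA /fintype.subsetP sB /forall_inP h.
apply/forall_inP => a /sA /h /forall_inP h'.
by apply/forall_inP => b /sB /h'.
Qed.

Lemma CN_neq0S A A' :
  A' \subset A -> CN A != finset.set0 -> CN A' != finset.set0.
Proof.
move=> /fintype.subsetP sA /finset.set0Pn[v]; rewrite inE => /forall_inP h.
by apply/finset.set0Pn; exists v; rewrite inE; apply/forall_inP => a /sA /h.
Qed.

Lemma B0_faces_down (s t : {set V * bool}) :
  s \in B0_faces -> t \subset s -> t \in B0_faces.
Proof.
rewrite !B0_facesP => /andP[dis bip] st.
have [s0 s1] := (part_sub false st, part_sub true st).
by rewrite (disjointWl s0 (disjointWr s1 dis)) (complete_bipartiteS s0 s1).
Qed.

Lemma B_faces_down (s t : {set V * bool}) :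
  s \in B_faces -> t \subset s -> t \in B_faces.
Proof.
rewrite !B_facesP => /and4P[dis bip n0 n1] st.
have [s0 s1] := (part_sub false st, part_sub true st).
rewrite (disjointWl s0 (disjointWr s1 dis)) (complete_bipartiteS s0 s1) //=.
by rewrite (CN_neq0S s0) // (CN_neq0S s1).
Qed.

Definition flip (p : V * bool) : V * bool := (p.1, ~~ p.2).

Lemma flipK : involutive flip.
Proof. by move=> [v b]; rewrite /flip /= negbK. Qed.

Lemma flip_uplus A B : flip @: uplus A B = uplus B A.
Proof.
apply/setP => -[v b]; rewrite -[(v, b) in LHS]flipK.
by rewrite mem_imset; [rewrite !in_uplus; case: b|exact: inv_inj flipK].
Qed.

Hypothesis Esym : symmetric E.

Lemma complete_bipartiteC A B : complete_bipartite A B -> complete_bipartite B A.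
Proof.
move=> /forall_inP h; apply/forall_inP => b bB; apply/forall_inP => a aA.
by rewrite Esym; have /forall_inP := h a aA; apply.
Qed.

Lemma B0_faces_flip (s : {set V * bool}) :
  s \in B0_faces -> flip @: s \in B0_faces.
Proof.
move=> /imsetP[[A B]]; rewrite inE /= => /andP[dis bip] ->.
apply/imsetP; exists (B, A); rewrite ?flip_uplus // inE /=.
by rewrite disjoint_sym dis complete_bipartiteC.
Qed.

Lemma B_faces_flip (s : {set V * bool}) :
  s \in B_faces -> flip @: s \in B_faces.
Proof.
move=> /imsetP[[A B]]; rewrite inE /= => /and4P[dis bip nA nB] ->.
apply/imsetP; exists (B, A); rewrite ?flip_uplus // inE /=.
by rewrite disjoint_sym dis complete_bipartiteC // nA nB.
Qed.

(* [A (+) B] goes to [B (+) A], by [flip_uplus]; invariance of the faces uses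
   the symmetry of the adjacency relation. *)
Definition B0_complex : Z2complex (V * bool)%type :=
  @MkZ2complex _ (MkComplex B0_faces_down) flip flipK B0_faces_flip.

Definition B_complex : Z2complex (V * bool)%type :=
  @MkZ2complex _ (MkComplex B_faces_down) flip flipK B_faces_flip.

End BoxComplexes.

(* Main.v *)
Require Import Defs.
From mathcomp Require Import all_boot all_order all_algebra generic_quotient.
From mathcomp Require Import all_classical all_reals.
From mathcomp Require Import interval_inference topology normedtype.

Set Implicit Arguments.
Unset Strict Implicit.
Unset Printing Implicit Defensive.
Import Order.TTheory GRing.Theory Num.Theory.
Import numFieldNormedType.Exports.

Local Open Scope classical_set_scope.
Local Open Scope ring_scope.
Local Open Scope quotient_scope.

(** A point of the realization of [B_0(G)] is a family of weights on two copies
    of [V], its sides [false] and [true].  Let [n] be the number of vertices and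
    [X_b] the total weight of side [b].  If both parts of a face of [B_0(G)] are
    nonempty, each lies in the common neighbourhood of the other; hence [B_0(G)]
    is [B(G)] together with the two full simplices on the sides.  Each of these
    simplices can be contracted to its barycenter, and [B(G)] can be pushed,
    inside itself, into either side.  Pushing [B(G)] into a side and then
    contracting maps a cone over [B(G)] to [B_0(G)]; the two cones obtained in
    this way, one per side, form the suspension.

    Everything is explicit thanks to one formula, [deform].  Pushing to side
    [false] during a time [s] lowers each weight of side [true] by [s X_true],
    down to 0 at the least, while a vertex [v] of side [false] gains
    [s X_true - n m(v)] when this is positive, where [m(v)] is the weight, on
    side [true], of the non-neighbours of [v].  If [v] gains, then
    [m(v) < s X_true / n], so that no non-neighbour of [v] keeps a positive
    weight: the support is still a face of [B_0(G)] ([deform_face0]).  The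
    support even stays in [B(G)] until time 1 ([deform_faceB]), because some
    vertex [u] of side [true] has weight at least [X_true / n] and is therefore
    adjacent to all that gain.  At time 1 side [true] is empty; from then on a
    constant weight is mixed in, and at time 2 only the barycenter of the side is
    left.  A negative [s] pushes to the other side, so that exchanging the sides
    amounts to negating [s]; this makes every map below equivariant.  The only
    obstruction is that the weights might vanish altogether; they do not for a
    point of [B(G)], nor if the side pushed to has a positive weight
    ([deform_sum_gt0]).

    Let [imbalance y = 2 (X_false - X_true)].  The equivalence [to_susp] sends
    [y] to the point over [y] at height [imbalance y] in the suspension, heights
    beyond [-1] and [1] denoting the apexes; points outside [B(G)] have height
    [-2] or [2].  Its homotopy inverse [of_susp] pushes [x] during the time [2 h] when [x]
    is at height [h].  One composite pushes [y] during the time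
    [2 (imbalance y)], and shortening this time to 0 is a homotopy to the identity
    ([B0_homotopy]): it only pushes to the heavier side.  For the other
    composite, [susp_slide] shortens the push of the base point, truncated to
    times in [[-1, 1]] where it remains in [B(G)], and moves the heights
    linearly; the truncation is harmless since a point pushed longer than 1 is
    sent to an apex. *)

(** * Continuity of maps built from other continuous maps *)

Section Continuity.

Lemma cts_comp (X Y Z : topologicalType) (f : X -> Y) (g : Y -> Z) :
  continuous g -> continuous f -> continuous (fun x => g (f x)).
Proof.
by move=> cg cf x; apply: (@continuous_comp _ _ _ f g); [exact: cf|exact: cg].
Qed.

Lemma cts_pair (X Y Z : topologicalType) (f : X -> Y) (g : X -> Z) :
  continuous f -> continuous g -> continuous (fun x => (f x, g x)).
Proof. by move=> cf cg x; apply: cvg_pair; [exact: cf|exact: cg]. Qed.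

Lemma cts_fst (X Y Z : topologicalType) (f : X -> Y * Z) :
  continuous f -> continuous (fun x => (f x).1).
Proof. by move=> cf; apply: cts_comp cf => y; exact: cvg_fst. Qed.

Lemma cts_snd (X Y Z : topologicalType) (f : X -> Y * Z) :
  continuous f -> continuous (fun x => (f x).2).
Proof. by move=> cf; apply: cts_comp cf => y; exact: cvg_snd. Qed.

Lemma cts_id (X : topologicalType) : continuous (fun x : X => x).
Proof. by move=> x; exact: cvg_id. Qed.

Lemma cts_cst (X Y : topologicalType) (y : Y) : continuous (fun x : X => y).
Proof. by move=> x; exact: cvg_cst. Qed.

(** The two branches agree on the closed set where the test is about to change, so
    near such a point both limits are the same. *)
Lemma cts_paste (R : realType) (X Y : topologicalType) (phi : X -> R) (f g : X -> Y) :
  continuous phi -> continuous f -> continuous g ->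
  (forall x, phi x = 0 -> f x = g x) ->
  continuous (fun x => if 0 <= phi x then f x else g x).
Proof.
move=> cphi cf cg fg x U.
have near_sign (A : set R) : open A -> A (phi x) -> \forall x' \near x, A (phi x').
  by move=> oA Ax; apply: cphi; exact: open_nbhs_nbhs.
case: (ltgtP (phi x) 0) => [lt0|gt0|eq0] => /= nU.
- have n0 := near_sign _ (@open_lt R 0) lt0.
  rewrite nbhs_simpl /=; have := cg x U nU; rewrite !nbhs_simpl /=.
  apply: filterS2 n0 => x' /=; by rewrite ltNge => /negbTE ->.
- have n0 := near_sign _ (@open_gt R 0) gt0.
  rewrite nbhs_simpl /=; have := cf x U nU; rewrite !nbhs_simpl /=.
  by apply: filterS2 n0 => x' /= /ltW ->.
- rewrite nbhs_simpl /=; have := cf x U nU.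
  have := cg x U; rewrite -(fg _ eq0) => /(_ nU).
  rewrite !nbhs_simpl /= => ng nf; apply: filterS2 ng nf => x' /= ? ?.
  by case: ifP.
Qed.

Lemma sigT_prod_continuous (I : choiceType) (A : I -> topologicalType)
    (Z Y : topologicalType) (F : {i : I & A i} * Z -> Y) :
  (forall i, continuous (fun p : A i * Z => F (existT A i p.1, p.2))) ->
  continuous F.
Proof.
move=> cF [[i a] z] U nU; have [[B C] /= [nB nC] BC] := cF i (a, z) U nU.
exists (existT A i @` B, C).
  by split => //; apply: filterS nB => a' Ba'; exists a'.
by move=> [_ z'] /= [[a' Ba' <-] Cz']; exact: (BC (a', z')).
Qed.

Lemma cts_if (Z Y : topologicalType) (b : Z -> bool) (f g : Z -> Y) :
  continuous b -> continuous f -> continuous g ->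
  continuous (fun z => if b z then f z else g z).
Proof.
move=> cb cf cg z U /= nU.
have nb : \forall z' \near z, b z' = b z.
  apply: (cb z [set c | c = b z]); apply: open_nbhs_nbhs.
  by split => //; exact: discrete_open.
rewrite nbhs_simpl /=; case: ifP nU => bz nU.
  have := cf z U nU; rewrite nbhs_simpl /=; apply: filterS2 nb => z' /= ->.
  by rewrite bz.
have := cg z U nU; rewrite nbhs_simpl /=; apply: filterS2 nb => z' /= ->.
by rewrite bz.
Qed.

Lemma cts_subtype (X Z : topologicalType) (A : set X) (f : Z -> set_type A) :
  continuous (fun z => \val (f z) : X) -> continuous f.
Proof. by move=> cf; apply: continuous_comp_initial; exact: cf. Qed.

(** A point of [B] that also lies in [A] nearby may be read as a point of [A]; the
    default value of [insubd] is chosen to be the limit itself, so that no base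
    point of [A] is required. *)
Lemma insubd_continuous (X : topologicalType) (A B : set X)
    (x : set_type A) (y : set_type B) :
  \val x = \val y -> (\forall y' \near y, \val y' \in A) ->
  (fun y' : set_type B => insubd x (\val y') : set_type A) @ y --> x.
Proof.
move=> xy nA U [_ [[O oO <-] /= Ox OU]].
have nO : \forall y' \near y, O (\val y').
  apply: (@initial_continuous _ _ (\val : set_type B -> X) y O).
  by apply: open_nbhs_nbhs; split; rewrite // -xy.
rewrite nbhs_simpl /=; apply: filterS2 nA nO => y' yA yO; apply: OU.
have yE : \val (insubd x (\val y') : set_type A) = \val y' by exact: insubdK.
by rewrite /= -[set_val _]/(\val _) yE.
Qed.

Lemma ptws_continuous (R : realType) (T : finType) (Z : topologicalType)
    (F : Z -> {ptws T -> R}) :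
  (forall v, continuous (fun z => F z v)) -> continuous F.
Proof.
move=> cF z.
have Ff : Filter (F @ z) by exact: (@fmap_filter _ _ _ _ (nbhs_filter z)).
apply/(@cvg_sup _ _ _ _ _ Ff) => v; apply/(@cvg_image _ _ _ _ _ Ff).
  by rewrite -subTset => r _; exists (fun=> r).
move=> U /(cF v) nU.
exists [set g : T -> R | U (g v)]; first exact: nU.
by rewrite eqEsubset; split => [r [g Ug <-]//|r Ur]; exists (fun=> r).
Qed.

End Continuity.

Section RealFunctions.
Variables (R : realType) (Z : topologicalType).
Implicit Types f g : Z -> R.

Lemma ctsD f g : continuous f -> continuous g -> continuous (fun z => f z + g z).
Proof. by move=> cf cg z; apply: (@cvgD R R^o); [exact: cf|exact: cg]. Qed.

Lemma ctsN f : continuous f -> continuous (fun z => - f z).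
Proof. by move=> cf z; apply: (@cvgN R R^o); exact: cf. Qed.

Lemma ctsB f g : continuous f -> continuous g -> continuous (fun z => f z - g z).
Proof. by move=> cf cg z; apply: (@cvgB R R^o); [exact: cf|exact: cg]. Qed.

Lemma ctsM f g : continuous f -> continuous g -> continuous (fun z => f z * g z).
Proof. by move=> cf cg z; apply: cvgM; [exact: cf|exact: cg]. Qed.

Lemma ctsV f : continuous f -> (forall z, f z != 0) -> continuous (fun z => (f z)^-1).
Proof. by move=> cf f0 z; apply: cvgV => //; exact: cf. Qed.

Lemma cts_norm f : continuous f -> continuous (fun z => `|f z|).
Proof. by move=> cf z; apply: (@cvg_norm R R^o); exact: cf. Qed.

Lemma cts_max f g :
  continuous f -> continuous g -> continuous (fun z => Num.max (f z) (g z)).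
Proof. by move=> cf cg z; apply: continuous_max; [exact: cf|exact: cg]. Qed.

Lemma cts_min f g :
  continuous f -> continuous g -> continuous (fun z => Num.min (f z) (g z)).
Proof. by move=> cf cg z; apply: continuous_min; [exact: cf|exact: cg]. Qed.

Lemma cts_sum (I : Type) (r : seq I) (P : pred I) (F : I -> Z -> R) :
  (forall i, continuous (F i)) -> continuous (fun z => \sum_(i <- r | P i) F i z).
Proof.
move=> cF; elim: r => [|i r IH].
  by under eq_fun do rewrite big_nil; exact: cts_cst.
under eq_fun do rewrite big_cons.
by case: (P i) => //; apply: ctsD.
Qed.

End RealFunctions.

(** * The unit interval and products of quotient maps with it *)

Section UnitInterval.
Variable R : realType.

Lemma clamp_subproof (r : R) : Num.max 0 (Num.min 1 r) \in (`[0, 1]%classic : set R).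
Proof.
apply/mem_set; rewrite /= in_itv /= le_max lexx /= ge_max ler01 /=.
by rewrite ge_min lexx.
Qed.

Definition clamp (r : R) : unitI R :=
  exist _ (Num.max 0 (Num.min 1 r)) (clamp_subproof r).

Lemma unitI_valP (t : unitI R) : 0 <= \val t <= 1.
Proof. by case: t => r /= /set_mem; rewrite /= in_itv. Qed.

Lemma clamp_val (t : unitI R) : clamp (\val t) = t.
Proof.
apply/val_inj => /=; have /andP[t0 t1] := unitI_valP t.
by rewrite min_r // max_r.
Qed.

Lemma clamp_ge1 (r : R) : 1 <= r -> clamp r = I1 R.
Proof. by move=> r1; apply/val_inj => /=; rewrite min_l // max_r. Qed.

Lemma clamp_le0 (r : R) : r <= 0 -> clamp r = I0 R.
Proof.
by move=> r1; apply/val_inj => /=; rewrite min_r ?max_l // (le_trans r1).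
Qed.

Lemma clamp_continuous : continuous clamp.
Proof.
apply: cts_subtype; apply: cts_max; first exact: cts_cst.
by apply: cts_min; [exact: cts_cst|exact: cts_id].
Qed.

Lemma unitI_val_continuous : continuous (fun t : unitI R => \val t : R).
Proof. exact: initial_continuous. Qed.

Lemma unitI_compact : compact [set: unitI R].
Proof.
have -> : [set: unitI R] = clamp @` `[0, 1].
  apply/seteqP; split => // t _; exists (\val t); last exact: clamp_val.
  exact: set_mem (valP t).
apply: continuous_compact (@segment_compact R 0 1).
by apply: continuous_subspaceT; exact: clamp_continuous.
Qed.

(** A quotient map times the identity of the interval is again a quotient map,
    because the interval is locally compact: in a compact neighbourhood [C] of
    [t], the points [z'] with [{z'} * C] inside a given open set form an open set,
    by the tube lemma upstairs.  Homotopies on a suspension need this. *)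
Lemma quotient_unitI_continuous (P Y : topologicalType) (Q0 : quotType P)
    (H : quotient_topology Q0 * unitI R -> Y) :
  continuous (fun pt : P * unitI R => H (\pi_(quotient_topology Q0) pt.1, pt.2)) ->
  continuous H.
Proof.
move=> cH [z t] U; rewrite nbhsE => -[U' [oU' U'z] U'U].
suff: nbhs (z, t) (H @^-1` U') by apply: filterS => p /= /U'U.
set q := \pi_(quotient_topology Q0).
have nU' p t' : U' (H (q p, t')) -> \forall p' \near p & t'' \near t', U' (H (q p', t'')).
  by move=> Upt; apply: (cH (p, t') U'); exact: open_nbhs_nbhs.
have qz : q (repr z) = z by exact: reprK.
have /= [[A B] [/= nA nB] AB] : nbhs (repr z, t) [set pt | U' (H (q pt.1, pt.2))].
  by apply: nU'; rewrite qz.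
have /= [_ [[D oD <-] /= Dt DB]] := nB.
have [e eD] : exists e : {posnum R}, closed_ball (\val t : R) e%:num `<=` D.
  by apply/nbhs_closedballP; exact: open_nbhs_nbhs.
pose C := [set t' : unitI R | closed_ball (\val t : R) e%:num (\val t')].
have nC : nbhs t C.
  apply: (@unitI_val_continuous t (closed_ball (\val t : R) e%:num)).
  by apply/nbhs_closedballP; exists e.
have cC : compact C.
  apply: subclosed_compact unitI_compact _ => //.
  apply: closed_comp; first by move=> ? _; exact: unitI_val_continuous.
  exact: closed_ball_closed.
have CB : C `<=` B by move=> t' /eD; exact: DB.
pose W := [set z' | forall t', C t' -> U' (H (z', t'))].
exists (W, C); last by move=> [z' t'] /= [Wz' Ct']; exact: Wz'.
split => //=; apply: open_nbhs_nbhs; split.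
  rewrite /open /= /quotient_open openE => p /= Wp.
  move: cC => /compact_near_coveringP/near_covering_withinP.
  move=> /(_ _ (nbhs p) (fun p' t' => U' (H (q p', t')))); apply.
  move=> t' Ct'; have [[A1 B1] [/= nA1 nB1] AB1] := nU' p t' (Wp t' Ct').
  by exists (B1, A1) => // -[t1 p1] /= [B1t A1p] _; exact: (AB1 (p1, t1)).
move=> t' Ct'; rewrite -qz; apply: (AB (repr z, t')); split => /=.
  exact: nbhs_singleton.
exact: CB.
Qed.

End UnitInterval.

(** * The suspension in signed heights *)
Section Suspension.
Variables (R : realType) (X : Z2space).
Local Notation S := (susp R X).

(** The points of the suspension over [x], with a signed height instead of an apex
    and a distance to the base.  Heights beyond [-1] and [1] give the apexes, so
    that no bound on [h] has to be carried around. *)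
Definition susp_point (x : X) (h : R) : S :=
  if 0 <= h then join_pi (in_mid (x, true, clamp h))
  else join_pi (in_mid (x, false, clamp (- h))).

Definition susp_apex (b : bool) : S := join_pi (in_right R X b).

Lemma join_pi_mid0 (x : X) (b : bool) :
  join_pi (in_mid (x, b, I0 R)) = join_pi (in_left R bool x).
Proof. by apply/join_piP => /=; rewrite eqxx. Qed.

Lemma I1_neq0 : (I1 R == I0 R) = false.
Proof. by apply/eqP => /(congr1 val) /= /eqP; rewrite oner_eq0. Qed.

Lemma join_pi_mid1 (x : X) (b : bool) :
  join_pi (in_mid (x, b, I1 R)) = susp_apex b.
Proof. by apply/join_piP => /=; rewrite I1_neq0 eqxx. Qed.

Lemma susp_point_mid (x : X) (b : bool) (t : unitI R) :
  join_pi (in_mid (x, b, t)) = susp_point x (if b then \val t else - \val t).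
Proof.
have /andP[t0 _] := unitI_valP t.
rewrite /susp_point; case: b; first by rewrite t0 clamp_val.
rewrite oppr_ge0 opprK clamp_val; case: ifP => // tle0.
have -> : t = I0 R.
  by apply/val_inj; apply: le_anti; apply/andP.
by rewrite /= oppr0 clamp_le0 // !join_pi_mid0.
Qed.

Lemma susp_point0 (x : X) : join_pi (in_left R bool x) = susp_point x 0.
Proof. by rewrite /susp_point lexx clamp_le0 // join_pi_mid0. Qed.

Lemma susp_point_ge1 (x : X) (h : R) : 1 <= h -> susp_point x h = susp_apex true.
Proof.
by move=> h1; rewrite /susp_point (le_trans ler01 h1) clamp_ge1 // join_pi_mid1.
Qed.

Lemma susp_point_leN1 (x : X) (h : R) : h <= -1 -> susp_point x h = susp_apex false.
Proof.
move=> h1; rewrite /susp_point leNgt (le_lt_trans h1) ?oppr_lt0 ?ltr01 //=.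
by rewrite clamp_ge1 ?join_pi_mid1 // lerNr.
Qed.

Lemma susp_pointP (z : S) :
  (exists x h, z = susp_point x h) \/ (exists b, z = susp_apex b).
Proof.
rewrite -[z]join_pi_repr; case: (repr z) => [[[]|]].
- by move=> b; right; exists b.
- by move=> x; left; exists x, 0; rewrite -susp_point0.
- move=> [[x b] t]; left; exists x, (if b then \val t else - \val t).
  by rewrite -susp_point_mid.
Qed.

Lemma susp_nu_apex (b : bool) : Z2_nu (susp_apex b) = susp_apex (~~ b).
Proof. by rewrite /= /susp_apex join_map_pi. Qed.

Lemma susp_nu_point (x : X) (h : R) :
  Z2_nu (susp_point x h) = susp_point (Z2_nu x) (- h).
Proof.
have nuE (b : bool) (t : unitI R) : Z2_nu (join_pi (in_mid (x, b, t)) : S) =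
    join_pi (in_mid (Z2_nu x, ~~ b, t)) by rewrite /= join_map_pi.
rewrite /susp_point; case: (ltgtP h 0) => h0.
- by rewrite nuE oppr_ge0 (ltW h0).
- by rewrite nuE oppr_ge0 leNgt h0 /= opprK.
- by rewrite nuE h0 oppr0 lexx clamp_le0 // !join_pi_mid0.
Qed.

Lemma susp_mid_continuous (b : bool) :
  continuous (fun p : X * unitI R => join_pi (in_mid (p.1, b, p.2)) : S).
Proof.
apply: (@cts_comp _ _ _ (fun p : X * unitI R => (p.1, b, p.2))
   (fun q => join_pi (in_mid q) : S)).
  apply: (@cts_comp _ _ _ (@in_mid R X bool) (@join_pi R X bool)).
    exact: pi_continuous.
  exact: (@existT_continuous _ (join_part R X bool) None).
apply: cts_pair; last by apply: cts_snd; exact: cts_id.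
by apply: cts_pair; [apply: cts_fst; exact: cts_id|exact: cts_cst].
Qed.

Lemma susp_point_continuous : continuous (fun p : X * R => susp_point p.1 p.2).
Proof.
have c1 : continuous (fst : X * R -> X) by apply: cts_fst; exact: cts_id.
have c2 : continuous (snd : X * R -> R) by apply: cts_snd; exact: cts_id.
apply: cts_paste => //.
- apply: (@cts_comp _ _ _ (fun p : X * R => (p.1, clamp p.2)) _ (@susp_mid_continuous true)).
  by apply: cts_pair => //; apply: cts_comp c2; exact: clamp_continuous.
- apply: (@cts_comp _ _ _ (fun p : X * R => (p.1, clamp (- p.2))) _ (@susp_mid_continuous false)).
  apply: cts_pair => //; apply: (@cts_comp _ _ _ (fun p : X * R => - p.2)).
    exact: clamp_continuous.
  exact: ctsN.
- by move=> [x h] /= ->; rewrite oppr0 clamp_le0 // !join_pi_mid0.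
Qed.

Section Recursor.
Variable Y : topologicalType.

Definition prejoin_rec (P : X -> R -> Y) (e : bool -> Y) (z : prejoin R X bool) : Y :=
  match z with
  | existT (Some false) x => P x 0
  | existT (Some true) b => e b
  | existT None p => P p.1.1 (if p.1.2 then \val p.2 else - \val p.2)
  end.

(** Maps out of the suspension are given by their values at signed heights; the
    compatibility condition covers all heights that denote an apex. *)
Definition susp_rec (P : X -> R -> Y) (e : bool -> Y) (z : S) : Y :=
  prejoin_rec P e (repr z).

Definition susp_compatible (P : X -> R -> Y) (e : bool -> Y) : Prop :=
  forall x h, (1 <= h -> P x h = e true) /\ (h <= -1 -> P x h = e false).

Lemma prejoin_rec_nf P e (z : prejoin R X bool) :
  susp_compatible P e -> prejoin_rec P e (join_nf z) = prejoin_rec P e z.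
Proof.
move=> Pe; case: z => [[[]|]] //= -[[x b] t] /=.
case: eqP => [->|_] /=; first by rewrite oppr0 if_same.
case: eqP => [->|_] //=; case: b.
  by rewrite (Pe x 1).1.
by rewrite (Pe x (-1)).2.
Qed.

Lemma susp_rec_pi P e (z : prejoin R X bool) :
  susp_compatible P e -> susp_rec P e (join_pi z) = prejoin_rec P e z.
Proof.
move=> Pe; rewrite /susp_rec -prejoin_rec_nf // -[RHS]prejoin_rec_nf //.
by congr prejoin_rec; have /join_piP/eqP := join_pi_repr (join_pi z).
Qed.

Lemma susp_rec_apex P e b :
  susp_compatible P e -> susp_rec P e (susp_apex b) = e b.
Proof. by move=> Pe; rewrite susp_rec_pi. Qed.

Lemma susp_rec_point P e x h :
  susp_compatible P e -> susp_rec P e (susp_point x h) = P x h.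
Proof.
move=> Pe; have [h1|h1] := leP 1 h.
  by rewrite susp_point_ge1 // susp_rec_apex // (Pe x h).1.
have [hN1|hN1] := leP h (-1).
  by rewrite susp_point_leN1 // susp_rec_apex // (Pe x h).2.
rewrite /susp_point; case: ifPn => [h0|]; rewrite susp_rec_pi //=.
  by rewrite min_r ?(ltW h1) // max_r.
rewrite -ltNge => h0; rewrite min_r ?max_r ?opprK //.
  by rewrite oppr_ge0 ltW.
by rewrite lerNl ltW.
Qed.

End Recursor.

Lemma susp_rec_continuous (Y : topologicalType)
    (P : X -> R -> unitI R -> Y) (e : bool -> unitI R -> Y) :
  (forall t, susp_compatible (fun x h => P x h t) (fun b => e b t)) ->
  continuous (fun p : X * R * unitI R => P p.1.1 p.1.2 p.2) ->
  (forall b, continuous (e b)) ->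
  continuous (fun q : S * unitI R =>
    susp_rec (fun x h => P x h q.2) (fun b => e b q.2) q.1).
Proof.
move=> Pe cP ce; apply: quotient_unitI_continuous.
under eq_fun => q do rewrite [susp_rec _ _ _](susp_rec_pi _ (Pe q.2)).
apply: sigT_prod_continuous => -[[]|] /=.
- move=> [b t] U /= nU; exists ([set b], [set t | U (e b t)]) => /=.
    split; last exact: ce nU.
    by apply: open_nbhs_nbhs; split => //; exact: discrete_open.
  by move=> [_ t'] [/= -> ].
- apply: (@cts_comp _ _ _ (fun p : X * unitI R => (p.1, 0, p.2)) _ cP).
  apply: cts_pair; last by apply: cts_snd; exact: cts_id.
  by apply: cts_pair; [apply: cts_fst; exact: cts_id|exact: cts_cst].
- apply: (@cts_comp _ _ _ (fun p : X * bool * unitI R * unitI R =>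
    (p.1.1.1, if p.1.1.2 then \val p.1.2 else - \val p.1.2, p.2)) _ cP).
  have cid := @cts_id (X * bool * unitI R * unitI R)%type.
  apply: cts_pair; last exact: cts_snd.
  apply: cts_pair; first by do 3 apply: cts_fst.
  have ct : continuous (fun p : X * bool * unitI R * unitI R => \val p.1.2 : R).
    apply: cts_comp; first exact: unitI_val_continuous.
    by apply: cts_snd; apply: cts_fst.
  apply: cts_if => //; last exact: ctsN.
  by apply: cts_snd; do 2 apply: cts_fst.
Qed.

End Suspension.

(** * Normalized weights *)
Section Normalization.
Variables (R : realType) (T : finType).
Implicit Types (K : complex T) (w : T -> R).

Definition support_set w : {set T} := [set v | w v != 0]%SET.

(** Unnormalized barycentric coordinates. *)
Definition weights K w : Prop :=
  [/\ forall v, 0 <= w v, 0 < \sum_v w v & support_set w \in faces K].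

Lemma normalize_subproof K w :
  weights K w -> (fun v => w v / \sum_u w u) \in @realization_set R T K.
Proof.
move=> [w0 w1 wK]; apply/mem_set; split => /=.
- by move=> v; rewrite divr_ge0 // ltW.
- by rewrite -mulr_suml divff // gt_eqF.
- suff -> : [set v | w v / \sum_u w u != 0]%SET = support_set w by [].
  by apply/setP => v; rewrite !inE mulf_eq0 invr_eq0 (gt_eqF w1) orbF.
Qed.

Definition normalize K w (h : weights K w) : realization R K :=
  exist _ (fun v => w v / \sum_u w u) (normalize_subproof h).

Lemma realization_weights K (x : realization R K) : weights K (\val x).
Proof. by case: x => x /= /set_mem [x0 x1 xK]; split => //; rewrite x1. Qed.

Lemma realization_sum K (x : realization R K) : \sum_v \val x v = 1.
Proof. by case: x => x /= /set_mem []. Qed.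

Lemma realization_ext K (x y : realization R K) :
  (forall v, \val x v = \val y v) -> x = y.
Proof. by move=> xy; apply/val_inj/funext. Qed.

(** Normalizing forgets a common factor; equalities between points of the
    realization are therefore checked on unnormalized weights. *)
Lemma normalize_scale K w w' (h : weights K w) (h' : weights K w') (c : R) :
  c != 0 -> (forall v, w v = c * w' v) -> normalize h = normalize h'.
Proof.
move=> c0 ww'; apply/val_inj/funext => v /=.
under eq_bigr do rewrite ww'.
by rewrite ww' -mulr_sumr invfM mulrACA divff // mul1r.
Qed.

Lemma normalize_realization K w (h : weights K w) (x : realization R K) (c : R) :
  c != 0 -> (forall v, w v = c * \val x v) -> normalize h = x.
Proof.
move=> c0 wx; rewrite (normalize_scale h (realization_weights x) c0 wx).
by apply/val_inj/funext => v /=; rewrite realization_sum divr1.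
Qed.

Lemma coord_continuous K (v : T) : continuous (fun x : realization R K => \val x v).
Proof.
move=> x; apply: (@continuous_comp _ _ _
  (\val : realization R K -> {ptws T -> R}) (fun z => z v)).
  exact: initial_continuous.
exact: (@proj_continuous T (fun _ => R) v).
Qed.

Lemma normalize_continuous (Z : topologicalType) K (w : Z -> T -> R)
    (h : forall z, weights K (w z)) :
  (forall v, continuous (fun z => w z v)) -> continuous (fun z => normalize (h z)).
Proof.
move=> cw; apply: cts_subtype; apply: ptws_continuous => v /=.
apply: ctsM => //; apply: ctsV; first exact: cts_sum.
by move=> z; have [_ + _] := h z; move=> /gt_eqF ->.
Qed.

End Normalization.

(** * Pushing the weights to one side *)

Section Deformation.
Variables (R : realType) (V : finType) (E : rel V).
Hypotheses (Esym : symmetric E) (Eirr : irreflexive E) (V0 : (0 < #|V|)%N).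
Local Notation T := (V * bool)%type.
Implicit Types (x : T -> R) (s : R) (b c : bool) (u v : V) (p : T).

(** Disjointness of the two parts follows from completeness as there are no loops,
    and by symmetry of [E] either side may be taken as the first one. *)
Lemma B0_facesE c (S : {set T}) :
  reflect (forall u v, (u, c) \in S -> (v, ~~ c) \in S -> E u v)
    (S \in faces (B0_complex Esym)).
Proof.
rewrite /= B0_facesP; apply: (iffP andP) => [[_ /forall_inP h] u v|h].
  case: c => uS vS; [rewrite Esym|].
    by apply: (forall_inP (h v _)); rewrite inE.
  by apply: (forall_inP (h u _)); rewrite inE.
have cb : complete_bipartite E (part false S) (part true S).
  apply/forall_inP => u; rewrite inE => uS; apply/forall_inP => v; rewrite inE => vS.
  by case: c h => h; [rewrite Esym|]; apply: h.
split => //; rewrite disjoint_subset; apply/fintype.subsetP => u uS.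
apply/negP => uS'; have := forall_inP (forall_inP cb u uS) u uS'.
by rewrite Eirr.
Qed.

Lemma B_facesE (S : {set T}) :
  S \in faces (B_complex Esym) <->
  S \in faces (B0_complex Esym) /\
    forall b, exists u, forall v, (v, b) \in S -> E v u.
Proof.
rewrite /= B_facesP B0_facesP; split.
  move=> /and4P[-> -> nf nt]; split => // b.
  have : CN E (part b S) != finset.set0 by case: b.
  move=> /finset.set0Pn[u]; rewrite inE => /forall_inP h.
  by exists u => v vS; apply: h; rewrite inE.
move=> [/andP[-> ->] h]; have CNb b : CN E (part b S) != finset.set0.
  have [u hu] := h b; apply/finset.set0Pn; exists u; rewrite inE.
  by apply/forall_inP => v; rewrite inE; exact: hu.
by rewrite !CNb.
Qed.

Definition side_mass x b : R := \sum_v x (v, b).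

Definition nonadjacent_mass x b u : R := \sum_(v | ~~ E u v) x (v, b).

(** The time spent pushing vertices away from side [b]; it vanishes for at least one
    of the two sides. *)
Definition toward b s : R := Num.max 0 (if b then s else - s).

(** The first summand is the weight that [p] keeps if its side is being emptied,
    plus what [p] gains if its side is being filled.  The factor in front and the
    last summand replace this by a constant weight on the filled side between the
    times 1 and 2.  For each sign of [s] only one of the two [toward] terms is
    nonzero, so no case distinction is needed. *)
Definition deform x s p : R :=
  Num.max 0 (2 - `|s|) *
    (Num.max 0 (x p - toward p.2 s * side_mass x p.2) +
     Num.max 0 (toward (~~ p.2) s * side_mass x (~~ p.2)
                - #|V|%:R * nonadjacent_mass x (~~ p.2) p.1)) +
  Num.max 0 (toward (~~ p.2) s - 1).

Lemma toward_ge0 b s : 0 <= toward b s.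
Proof. by rewrite /toward le_max lexx. Qed.

Lemma towardN b s : toward b (- s) = toward (~~ b) s.
Proof. by case: b; rewrite /toward ?opprK. Qed.

(** [c] is the side that is being filled. *)
Lemma toward_side s : exists c, toward c s = 0 /\ toward (~~ c) s = `|s|.
Proof.
have [s0|s0] := leP 0 s; [exists false|exists true].
  by rewrite /toward /= max_l ?oppr_le0 // max_r ?ger0_norm.
by rewrite /toward /= max_l ?(ltW s0) // max_r ?oppr_ge0 ?(ltW s0) // ltr0_norm.
Qed.

Lemma deform_flip x s p : deform (x \o @flip V) (- s) p = deform x s (flip p).
Proof.
case: p => v b; rewrite /deform /= !towardN normrN /side_mass /nonadjacent_mass /=.
by rewrite /flip /= !negbK.
Qed.

Lemma deform_ge0 x s p : 0 <= deform x s p.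
Proof.
rewrite addr_ge0 ?mulr_ge0 ?addr_ge0 //; by rewrite le_max lexx.
Qed.

Lemma side_mass_ge0 x b : (forall p, 0 <= x p) -> 0 <= side_mass x b.
Proof. by move=> x0; apply: sumr_ge0. Qed.

Lemma nonadjacent_mass_ge0 x b u : (forall p, 0 <= x p) -> 0 <= nonadjacent_mass x b u.
Proof. by move=> x0; apply: sumr_ge0. Qed.

Lemma le_nonadjacent_mass x b u v :
  (forall p, 0 <= x p) -> ~~ E u v -> x (v, b) <= nonadjacent_mass x b u.
Proof.
move=> x0 uv; rewrite /nonadjacent_mass (bigD1 v) //= lerDl.
exact: sumr_ge0.
Qed.

Lemma nonadjacent_mass_eq0 x b u :
  (forall v, x (v, b) != 0 -> E u v) -> nonadjacent_mass x b u = 0.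
Proof.
by move=> h; apply: big1 => v; apply: contraNeq => /h.
Qed.

Lemma side_mass_sum x : \sum_p x p = side_mass x false + side_mass x true.
Proof.
rewrite /side_mass -big_split /= [LHS](eq_bigr (fun p => x (p.1, p.2))); last by case.
rewrite -(pair_bigA _ (fun v b => x (v, b))) /=; apply: eq_bigr => v _.
by rewrite big_bool addrC.
Qed.

Lemma side_mass_gt0 x b : 0 < side_mass x b -> exists v, x (v, b) != 0.
Proof.
move=> xb; apply/existsP; apply: contraTT xb; rewrite negb_exists => /forallP h.
rewrite -leNgt /side_mass big1 // => v _; apply/eqP.
by have := h v; rewrite negbK.
Qed.

Lemma toward0 b : toward b 0 = 0.
Proof. by rewrite /toward oppr0 if_same maxxx. Qed.

Lemma deform0 x p : (forall p, 0 <= x p) -> deform x 0 p = 2 * x p.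
Proof.
move=> x0; rewrite /deform !toward0 !mul0r normr0 !subr0 !sub0r max_r //.
rewrite [Num.max 0 (x p)]max_r // ![Num.max 0 (- _)]max_l ?oppr_le0 ?addr0 //.
by rewrite mulr_ge0 // nonadjacent_mass_ge0.
Qed.

Lemma max0_neq0 (r : R) : (Num.max 0 r != 0) = (0 < r).
Proof.
have [r0|r0] := ltP 0 r; first by rewrite gt_eqF.
by rewrite eqxx.
Qed.

Lemma max0_ge0 (r : R) : 0 <= Num.max 0 r.
Proof. by rewrite le_max lexx. Qed.

Lemma natr_card_gt0 : 0 < #|V|%:R :> R.
Proof. by rewrite ltr0n. Qed.

Section Sides.
Variables (x : T -> R) (s : R) (c : bool).
Hypotheses (x0 : forall p, 0 <= x p) (sc : toward c s = 0).

Lemma deform_receding v :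
  deform x s (v, ~~ c) =
  Num.max 0 (2 - `|s|) * Num.max 0 (x (v, ~~ c) - toward (~~ c) s * side_mass x (~~ c)).
Proof.
rewrite /deform /= negbK sc mul0r sub0r [Num.max 0 (- _)]max_l; last first.
  by rewrite oppr_le0 mulr_ge0 // nonadjacent_mass_ge0.
by rewrite sub0r [Num.max 0 (- 1)]max_l ?oppr_le0 // !addr0.
Qed.

Lemma deform_growing v :
  deform x s (v, c) =
  Num.max 0 (2 - `|s|) *
    (x (v, c) + Num.max 0 (toward (~~ c) s * side_mass x (~~ c)
                           - #|V|%:R * nonadjacent_mass x (~~ c) v)) +
  Num.max 0 (toward (~~ c) s - 1).
Proof. by rewrite /deform /= sc mul0r subr0 [Num.max 0 (x _)]max_r. Qed.

Lemma deform_receding_neq0 v :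
  deform x s (v, ~~ c) != 0 -> toward (~~ c) s * side_mass x (~~ c) < x (v, ~~ c).
Proof. by rewrite deform_receding mulf_eq0 negb_or !max0_neq0 !subr_gt0 => /andP[]. Qed.

Lemma deform_growing_neq0 v : deform x s (v, c) != 0 ->
  [\/ x (v, c) != 0,
      #|V|%:R * nonadjacent_mass x (~~ c) v < toward (~~ c) s * side_mass x (~~ c)
    | 1 < toward (~~ c) s].
Proof.
rewrite deform_growing; have [->|xv _] := eqVneq (x (v, c)) 0; last by constructor 1.
have [lt1|le1] := ltP 1 (toward (~~ c) s); first by constructor 3.
rewrite [Num.max 0 (_ - 1)]max_l ?subr_le0 // addr0 add0r mulf_eq0 negb_or !max0_neq0.
by rewrite !subr_gt0 => /andP[_ ?]; constructor 2.
Qed.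

Lemma deform_late : 1 <= toward (~~ c) s -> forall v, deform x s (v, ~~ c) = 0.
Proof.
move=> s1 v; apply/eqP/negPn/negP => /deform_receding_neq0.
rewrite ltNge => /negP; apply; apply: (@le_trans _ _ (side_mass x (~~ c))).
  by rewrite /side_mass (bigD1 v) //= lerDl sumr_ge0.
by rewrite ler_peMl // side_mass_ge0.
Qed.

(** A vertex [u] of the growing side and a vertex [v] of the receding side, both in
    the new support, are adjacent: if [u] was in the old support, this was so
    before; if [u] gains weight without being adjacent to [v], then
    [x v <= m(u) <= n m(u) < s X < x v], where [m(u)] is the weight of the
    non-neighbours of [u] and [X] that of the receding side.  After time 1 the
    receding side is empty. *)
Lemma deform_face0 : support_set x \in faces (B0_complex Esym) ->
  support_set (deform x s) \in faces (B0_complex Esym).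
Proof.
move=> /(B0_facesE c) xface; apply/(B0_facesE c) => u v; rewrite !inE.
move=> /deform_growing_neq0 [xu|xu|s1] dv; have xv := deform_receding_neq0 dv.
- apply: xface; rewrite inE // gt_eqF // (le_lt_trans _ xv) //.
  by rewrite mulr_ge0 ?toward_ge0 ?side_mass_ge0.
- apply/negPn/negP => /(le_nonadjacent_mass (~~ c) x0) xuv.
  have : nonadjacent_mass x (~~ c) u < nonadjacent_mass x (~~ c) u.
    rewrite (le_lt_trans _ (lt_le_trans xv xuv)) // (le_trans _ (ltW xu)) //.
    by rewrite ler_peMl ?nonadjacent_mass_ge0 // ler1n.
  by rewrite ltxx.
- by move: dv; rewrite deform_late ?eqxx // ltW.
Qed.

(** If the growing side is empty, a common neighbour of the receding side has no
    weight among its non-neighbours, hence gains weight as soon as [s <> 0]. *)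
Lemma deform_sum_gt0 : toward (~~ c) s = `|s| -> 0 < \sum_p x p ->
  [\/ s = 0, 0 < side_mass x c | exists u, forall v, x (v, ~~ c) != 0 -> E v u] ->
  0 < \sum_p deform x s p.
Proof.
move=> sE xs adm; suff [p dp] : exists p, 0 < deform x s p.
  rewrite (bigD1 p) //= ltr_pwDl // sumr_ge0 // => ? _; exact: deform_ge0.
have [lt2|ge2] := ltP `|s| 2; last first.
  have [v _] : exists v : V, v \in V by apply/card_gt0P.
  exists (v, c); rewrite deform_growing ltr_wpDl ?mulr_ge0 ?addr_ge0 ?max0_ge0 //.
  by rewrite lt_max subr_gt0 sE (lt_le_trans _ ge2) ?orbT // ltr1n.
have lam : 0 < Num.max 0 (2 - `|s|) by rewrite lt_max subr_gt0 lt2 orbT.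
have growing v : x (v, c) != 0 -> exists p, 0 < deform x s p.
  move=> xv; exists (v, c); rewrite deform_growing ltr_wpDr ?max0_ge0 // mulr_gt0 //.
  by rewrite ltr_wpDr ?max0_ge0 // lt_neqAle eq_sym xv x0.
(* At time 0 the weights have merely doubled. *)
have [->|s0] := eqVneq s 0.
  have [p xp] : exists p, x p != 0.
    apply/existsP; apply: contraTT xs; rewrite negb_exists -leNgt => /forallP h.
    by rewrite big1 // => p _; apply/eqP; have := h p; rewrite negbK.
  by exists p; rewrite deform0 // mulr_gt0 // lt_neqAle eq_sym xp x0.
have [/side_mass_gt0 [v /growing //]|xc] := ltP 0 (side_mass x c).
have xd : 0 < side_mass x (~~ c).
  move: xs; rewrite side_mass_sum; have xc0 : side_mass x c = 0.
    by apply/eqP; rewrite eq_le xc side_mass_ge0.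
  by case: (c) xc0 => /= ->; rewrite ?addr0 ?add0r.
case: adm => [s00|xc'|[u xu]]; first by rewrite s00 eqxx in s0.
  by rewrite ltNge xc in xc'.
exists (u, c); rewrite deform_growing ltr_wpDr ?max0_ge0 // mulr_gt0 //.
rewrite ltr_wpDl // nonadjacent_mass_eq0; last by move=> v /xu; rewrite Esym.
by rewrite mulr0 subr0 sE lt_max mulr_gt0 ?orbT // normr_gt0.
Qed.

(** The receding part only shrinks, so it keeps its common neighbours.  For the
    growing part, a vertex of the receding side that carries at least the average
    weight is a common neighbour: a vertex not adjacent to it cannot gain. *)
Lemma deform_faceB : toward (~~ c) s <= 1 ->
  support_set x \in faces (B_complex Esym) ->
  support_set (deform x s) \in faces (B_complex Esym).
Proof.
move=> s1 /B_facesE [xface xCN]; apply/B_facesE; split; first exact: deform_face0.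
suff [grow rec] : (exists u, forall v, deform x s (v, c) != 0 -> E v u) /\
    (exists u, forall v, deform x s (v, ~~ c) != 0 -> E v u).
  move=> b; have [->|bc] := eqVneq b c.
    by have [u hu] := grow; exists u => v; rewrite inE => /hu.
  have -> : b = ~~ c by move: bc; clear; case: b; case: c.
  by have [u hu] := rec; exists u => v; rewrite inE => /hu.
split; last first.
  have [u xu] := xCN (~~ c); exists u => v /deform_receding_neq0 xv.
  apply: xu; rewrite inE gt_eqF // (le_lt_trans _ xv) //.
  by rewrite mulr_ge0 ?toward_ge0 ?side_mass_ge0.
(* If the receding side is empty, no vertex gains and the support is unchanged. *)
have [xd|xd] := ltP 0 (side_mass x (~~ c)); last first.
  have [u xu] := xCN c; exists u => v /deform_growing_neq0 [xv|xv|].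
  - by apply: xu; rewrite inE.
  - have : 0 < (0 : R).
      rewrite (le_lt_trans _ (lt_le_trans xv _)) //.
        by rewrite mulr_ge0 // nonadjacent_mass_ge0.
      by rewrite mulr_ge0_le0 // toward_ge0.
    by rewrite ltxx.
  - by rewrite ltNge s1.
(* A weight that is at least the average one. *)
have [u xu] : exists u, side_mass x (~~ c) <= #|V|%:R * x (u, ~~ c).
  apply/existsP; apply: contraTT isT; rewrite negb_exists => /forallP h.
  have : \sum_(v : V) #|V|%:R * x (v, ~~ c) < \sum_(v : V) side_mass x (~~ c).
    have [v0 _] : exists v : V, v \in V by apply/card_gt0P.
    apply: ltr_sum; last by move=> v _; rewrite ltNge.
    by apply/hasP; exists v0; rewrite ?mem_index_enum.
  by rewrite -mulr_sumr sumr_const mulr_natl ltxx.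
have xu0 : x (u, ~~ c) != 0.
  by rewrite gt_eqF // -(pmulr_rgt0 _ natr_card_gt0) (lt_le_trans xd).
exists u => v /deform_growing_neq0 [xv|xv|]; last by rewrite ltNge s1.
  by apply: (elimT (B0_facesE c _) xface); rewrite inE.
apply/negPn/negP => /(le_nonadjacent_mass (~~ c) x0) xuv.
have : side_mass x (~~ c) < side_mass x (~~ c).
  rewrite (le_lt_trans xu) // (le_lt_trans _ (lt_le_trans xv _)) //.
    by rewrite ler_wpM2l.
  by rewrite ler_piMl // side_mass_ge0.
by rewrite ltxx.
Qed.

End Sides.

End Deformation.

(** * The two maps and the two homotopies *)
Section Equivalence.
Variables (R : realType) (V : finType) (E : rel V).
Hypotheses (Esym : symmetric E) (Eirr : irreflexive E) (V0 : (0 < #|V|)%N).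
Local Notation T := (V * bool)%type.
Local Notation K := (B0_complex Esym).
Local Notation L := (B_complex Esym).
Local Notation KS := (Z2realization R K).
Local Notation LS := (Z2realization R L).
Implicit Types (x : T -> R) (s : R) (b c : bool) (v : V) (p : T).

(** The conditions of [deform_sum_gt0], for the side [c] that is being filled. *)
Definition admissible x s : Prop :=
  forall c, toward c s = 0 -> toward (~~ c) s = `|s| ->
  [\/ s = 0, 0 < side_mass x c | exists u, forall v, x (v, ~~ c) != 0 -> E v u].

Lemma deform_weights0 x s :
  weights K x -> admissible x s -> weights K (deform E x s).
Proof.
move=> [x0 xs xK] adm; have [c [sc sE]] := toward_side s.
split; first by move=> p; exact: deform_ge0.
  by apply: (deform_sum_gt0 Esym V0 x0 sc) => //; exact: adm.
exact: (deform_face0 Eirr V0 x0 sc).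
Qed.

Lemma deform_weightsB x s :
  weights L x -> `|s| <= 1 -> weights L (deform E x s).
Proof.
move=> [x0 xs xL] s1; have [c [sc sE]] := toward_side s.
split; first by move=> p; exact: deform_ge0.
  apply: (deform_sum_gt0 Esym V0 x0 sc) => //.
  constructor 3; have /B_facesE [_ xCN] := xL; have [u xu] := xCN (~~ c).
  by exists u => v xv; apply: xu; rewrite inE.
by apply: (deform_faceB Eirr V0 x0 sc) => //; rewrite sE.
Qed.

Lemma weightsB0 x : weights L x -> weights K x.
Proof. by move=> [x0 xs /B_facesE[]]. Qed.

Lemma weightsB_admissible x s : weights L x -> admissible x s.
Proof.
move=> [x0 xs /B_facesE[_ xCN]] c _ _; constructor 3.
by have [u xu] := xCN (~~ c); exists u => v xv; apply: xu; rewrite inE.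
Qed.

(** The factor 2 makes the height of a point of [B_0(G)] reach [-1] and [1] while the
    point is still inside [B(G)], which makes [to_susp] locally constant around
    the points outside [B(G)]. *)
Definition imbalance x : R := 2 * (side_mass x false - side_mass x true).

(** Pushing in proportion to the imbalance fills the heavier side, whose weight
    cannot be 0. *)
Lemma imbalance_admissible x (t : R) : weights K x -> 0 <= t ->
  admissible x (t * imbalance x).
Proof.
move=> [x0 xs _] t0 c sc sE.
have [->|s0] := eqVneq (t * imbalance x) 0; first by constructor 1.
constructor 2; have [m0 m1] := (side_mass_ge0 false x0, side_mass_ge0 true x0).
have sgt : 0 < if ~~ c then t * imbalance x else - (t * imbalance x).
  by rewrite -max0_neq0 -/(toward _ _) sE normr_eq0.
have tgt : 0 < t.
  rewrite lt_neqAle t0 andbT eq_sym.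
  by apply: contraNneq s0 => ->; rewrite mul0r.
move: sgt; case: (c) => /=.
  rewrite -mulrN pmulr_rgt0 // /imbalance -mulrN opprB pmulr_rgt0 // subr_gt0.
  exact: le_lt_trans.
by rewrite pmulr_rgt0 // /imbalance pmulr_rgt0 // subr_gt0; exact: le_lt_trans.
Qed.

Definition signed b (r : R) : R := if b then r else - r.

Lemma imbalance_flip x : imbalance (x \o @flip V) = - imbalance x.
Proof. by rewrite /imbalance /side_mass /= -mulrN opprB. Qed.

Lemma imbalance_one_sided (y : KS) b :
  side_mass (\val y) b = 0 -> imbalance (\val y) = signed b 2.
Proof.
have := realization_sum y; rewrite side_mass_sum /imbalance.
case: b => /= sE yb; move: sE; rewrite yb ?addr0 ?add0r => ->.
  by rewrite subr0 mulr1.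
by rewrite mulrN mulr1.
Qed.

(** If both sides carry weight, a vertex of either side is a common neighbour of the
    other side. *)
Lemma realization_cases (y : KS) :
  (exists x : LS, \val x = \val y) \/ (exists b, side_mass (\val y) b = 0).
Proof.
have [/forallP yb|/forallPn [b]] := boolP [forall b, side_mass (\val y) b != 0]; last first.
  by rewrite negbK => /eqP yb; right; exists b.
left; suff yL : \val y \in @realization_set R T L by exists (exist _ (\val y) yL).
have [y0 _ yK] := realization_weights y.
apply/mem_set; split => //; first exact: realization_sum.
apply/B_facesE; split => // b.
have [u yu] : exists u, \val y (u, ~~ b) != 0.
  by apply: side_mass_gt0; rewrite lt_neqAle eq_sym yb side_mass_ge0.
exists u => v yv.
by apply: (elimT (B0_facesE Esym Eirr b _) yK); rewrite // inE.
Qed.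

Lemma deform_pole b s x p : (forall p, 0 <= x p) -> 2 <= signed b s ->
  deform E x s p = (signed b s - 1) * (p.2 != b)%:R.
Proof.
move=> x0 s2; have s0 : 0 <= signed b s by exact: le_trans s2.
have sE : `|s| = signed b s.
  move: s0; rewrite /signed; case: (b) => s0; first by rewrite ger0_norm.
  by rewrite ler0_norm // -oppr_ge0.
have tb : toward b s = signed b s by rewrite /toward max_r.
have tNb : toward (~~ b) s = 0.
  rewrite /toward max_l //; move: s0; rewrite /signed.
  by case: (b) => /=; rewrite ?oppr_le0 ?oppr_ge0.
rewrite /deform sE [Num.max 0 (2 - _)]max_l ?subr_le0 // mul0r add0r.
have [->|pb] := eqVneq p.2 b.
  by rewrite tNb mulr0 max_l // sub0r oppr_le0.
have -> : ~~ p.2 = b by move: pb; case: (p.2); case: (b).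
by rewrite tb mulr1 max_r // subr_ge0 (le_trans _ s2) // ler1n.
Qed.

Lemma pole_weights b : weights K (fun p : T => (p.2 != b)%:R : R).
Proof.
have [v _] : exists v : V, v \in V by apply/card_gt0P.
split; first by move=> p; exact: ler0n.
  rewrite (bigD1 (v, ~~ b)) //= (_ : ~~ b != b); last by case: (b).
  by rewrite ltr_pwDl ?ltr01 // sumr_ge0 // => p _; exact: ler0n.
apply/(B0_facesE Esym Eirr b) => u w; rewrite !inE /=.
by rewrite eqxx eqxx.
Qed.

(** The barycenter of the side opposite to [b]: heights are positive where side
    [false] is the heavier one. *)
Definition pole b : KS := normalize (pole_weights b).

(** The path of [x] to the barycenter of a side, inside [B_0(G)]; it is constant
    for times beyond [-2] and [2]. *)
Definition push (x : LS) s : KS :=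
  normalize (deform_weights0 (weightsB0 (realization_weights x))
               (@weightsB_admissible _ s (realization_weights x))).

Lemma push_pole (x : LS) s b : 2 <= signed b s -> push x s = pole b.
Proof.
move=> s2; apply: (@normalize_scale _ _ _ _ _ _ _ (signed b s - 1)).
  by rewrite gt_eqF // subr_gt0 (lt_le_trans _ s2) // ltr1n.
by move=> p; apply: deform_pole s2; have [] := realization_weights x.
Qed.

Definition clamp_pm1 (r : R) : R := Num.max (- 1) (Num.min 1 r).

Lemma clamp_pm1_norm r : `|clamp_pm1 r| <= 1.
Proof.
by rewrite ler_norml le_max lexx /= ge_max ge_min lexx andbT (le_trans (lerN10 R)).
Qed.

Lemma clamp_pm1_id r : `|r| <= 1 -> clamp_pm1 r = r.
Proof. by rewrite ler_norml => /andP[r0 r1]; rewrite /clamp_pm1 min_r // max_r. Qed.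

(** The part of the path of [x] that remains in [B(G)], stopped at the times [-1]
    and [1]. *)
Definition pushB (x : LS) s : LS :=
  normalize (deform_weightsB (realization_weights x) (clamp_pm1_norm s)).

Lemma pushB_push (x : LS) s : `|s| <= 1 -> \val (pushB x s) = \val (push x s).
Proof. by move=> s1; rewrite /= clamp_pm1_id. Qed.

Lemma pushB0 (x : LS) : pushB x 0 = x.
Proof.
have [x0 _ _] := realization_weights x.
apply: (@normalize_realization _ _ _ _ _ _ 2) => // p.
by rewrite clamp_pm1_id ?normr0 // deform0.
Qed.

(** After time 1 one side is empty. *)
Lemma imbalance_push (x : LS) s b :
  1 <= signed b s -> imbalance (\val (push x s)) = signed b 2.
Proof.
move=> s1; apply: imbalance_one_sided; apply: big1 => v _ /=.
have [x0 _ _] := realization_weights x.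
rewrite -[b]negbK (deform_late E x0) ?mul0r //.
- rewrite /toward max_l //; move: s1; rewrite /signed; case: (b) => /= s1.
    by rewrite oppr_le0 (le_trans _ s1).
  by rewrite -oppr_ge0 (le_trans _ s1).
- by rewrite negbK /toward -/(signed b s) le_max s1 orbT.
Qed.

Lemma deform_continuous (Z : topologicalType) (phi : Z -> T -> R) (sg : Z -> R) p :
  (forall q, continuous (fun z => phi z q)) -> continuous sg ->
  continuous (fun z => deform E (phi z) (sg z) p).
Proof.
move=> cphi csg.
have ctoward b : continuous (fun z => toward b (sg z)).
  by case: b; apply: cts_max => //; try exact: cts_cst; exact: ctsN.
have cmass b : continuous (fun z => side_mass (phi z) b) by apply: cts_sum.
have cnon b u : continuous (fun z => nonadjacent_mass E (phi z) b u) by apply: cts_sum.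
have c0 : continuous (fun _ : Z => 0 : R) by exact: cts_cst.
have c1 : continuous (fun _ : Z => 1 : R) by exact: cts_cst.
apply: ctsD; last by apply: cts_max => //; exact: ctsB.
apply: ctsM.
  by apply: cts_max => //; apply: ctsB; [exact: cts_cst|exact: cts_norm].
apply: ctsD; apply: cts_max => //; apply: ctsB => //; apply: ctsM => //.
exact: cts_cst.
Qed.

Lemma imbalance_continuous (Z : topologicalType) (phi : Z -> T -> R) :
  (forall q, continuous (fun z => phi z q)) -> continuous (fun z => imbalance (phi z)).
Proof.
move=> cphi; apply: ctsM; first exact: cts_cst.
by apply: ctsB; exact: cts_sum.
Qed.

Definition to_susp (y : KS) : susp R LS :=
  if insub (\val y) is Some x then susp_point (x : LS) (imbalance (\val y))
  else susp_apex R LS (0 <= imbalance (\val y)).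

Lemma to_susp_point (y : KS) (x : LS) :
  \val x = \val y -> to_susp y = susp_point x (imbalance (\val y)).
Proof. by move=> xy; rewrite /to_susp -xy valK. Qed.

Lemma to_susp_apex (y : KS) b :
  1 <= signed b (imbalance (\val y)) -> to_susp y = susp_apex R LS b.
Proof.
rewrite /to_susp /signed; case: b => h; case: insub => [x|].
- by rewrite susp_point_ge1.
- by rewrite (le_trans ler01).
- by rewrite susp_point_leN1 // lerNr.
- by rewrite leNgt -oppr_gt0 (lt_le_trans ltr01).
Qed.

Lemma realization_nu_coord (y : KS) : \val (Z2_nu y) = \val y \o @flip V.
Proof. by []. Qed.

Lemma to_susp_nu (y : KS) : to_susp (Z2_nu y) = Z2_nu (to_susp y).
Proof.
have [[x xy]|[b yb]] := realization_cases y.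
  rewrite (to_susp_point xy) susp_nu_point -imbalance_flip.
  by rewrite (@to_susp_point _ (Z2_nu x)) //= -xy.
have yE := imbalance_one_sided yb.
rewrite (@to_susp_apex y b); last by rewrite yE; case: (b) => /=; rewrite ?opprK ler1n.
rewrite susp_nu_apex; apply: to_susp_apex.
rewrite realization_nu_coord imbalance_flip yE.
by case: (b); rewrite /signed /= ?opprK ler1n.
Qed.

(** Where the height is beyond [-1] or [1] the map is locally constant.  Elsewhere
    both sides carry weight, so that all nearby points lie in [B(G)] and
    [susp_point] applies to them. *)
Lemma to_susp_continuous : continuous to_susp.
Proof.
have cval p : continuous (fun y : KS => \val y p) by exact: coord_continuous.
have cimb : continuous (fun y : KS => imbalance (\val y)) by exact: imbalance_continuous.
have cmass b : continuous (fun y : KS => side_mass (\val y) b).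
  by apply: cts_sum => u; exact: cval.
have far b (y : KS) : 1 < signed b (imbalance (\val y)) ->
    \forall y' \near y, to_susp y' = susp_apex R LS b.
  move=> h; have csig : continuous (fun y : KS => signed b (imbalance (\val y))).
    by rewrite /signed; case: (b) => //; exact: ctsN.
  have : \forall y' \near y, 1 < signed b (imbalance (\val y')).
    by apply: (csig y [set r | 1 < r]); apply: open_nbhs_nbhs; split => //; exact: open_gt.
  by apply: filterS => y' /ltW /to_susp_apex.
have far_continuous b (y : KS) : 1 < signed b (imbalance (\val y)) ->
    {for y, continuous to_susp}.
  move=> h U; rewrite (to_susp_apex (ltW h)) => nU.
  have Ub : U (susp_apex R LS b) by exact: nbhs_singleton nU.
  by rewrite nbhs_simpl /=; apply: filterS (far b y h) => y' /= ->.
move=> y; have [hi|hi] := ltP 1 (imbalance (\val y)); first exact: (far_continuous true).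
have [lo|lo] := ltP 1 (- imbalance (\val y)); first exact: (far_continuous false).
have pos b : 0 < side_mass (\val y) b.
  have [y0 _ _] := realization_weights y.
  rewrite lt_neqAle side_mass_ge0 // andbT eq_sym; apply/eqP => /imbalance_one_sided yE.
  move: hi lo; rewrite yE /signed; case: (b) => /=; rewrite ?opprK => hi lo.
    by rewrite lern1 in hi.
  by rewrite lern1 in lo.
have npos b : \forall y' \near y, 0 < side_mass (\val y') b.
  apply: (cmass b y [set r : R | 0 < r]); apply: open_nbhs_nbhs.
  by split; [exact: open_gt|exact: pos].
have nL : \forall y' \near y, \val y' \in @realization_set R T L.
  apply: filterS2 (npos false) (npos true) => y' yf yt.
  have [[x <-]|[b yb]] := realization_cases y'; first exact: valP.
  by case: b yb => yb; [rewrite yb ltxx in yt|rewrite yb ltxx in yf].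
have [[x xy]|[b yb]] := realization_cases y; last by have := pos b; rewrite yb ltxx.
have cx : (fun y' : KS => insubd x (\val y') : LS) @ y --> x by exact: insubd_continuous.
have cpt : (fun y' : KS => susp_point (insubd x (\val y') : LS) (imbalance (\val y'))) @ y -->
    susp_point x (imbalance (\val y)).
  apply: (@cvg_comp _ _ _ (fun y' : KS => (insubd x (\val y') : LS, imbalance (\val y')))
    (fun p : LS * R => susp_point p.1 p.2) _ (nbhs (x, imbalance (\val y)))).
    exact: (cvg_pair cx (cimb y)).
  exact: (@susp_point_continuous R LS (x, imbalance (\val y))).
move=> U; rewrite /= (to_susp_point xy) => /cpt; rewrite !nbhs_simpl /=.
apply: filterS2 nL => y' yL /=; rewrite -(@to_susp_point y') //.
exact: insubdK.
Qed.

Definition of_susp : susp R LS -> KS :=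
  susp_rec (fun (x : LS) h => push x (2 * h)) pole.

Lemma of_susp_compatible :
  susp_compatible (fun (x : LS) (h : R) => push x (2 * h)) pole.
Proof.
move=> x h; split => h1; apply: push_pole; rewrite /signed.
  by rewrite ler_peMr.
by rewrite -mulrN ler_peMr // lerNr.
Qed.

Lemma of_susp_point (x : LS) (h : R) : of_susp (susp_point x h) = push x (2 * h).
Proof. exact: susp_rec_point of_susp_compatible. Qed.

Lemma of_susp_apex b : of_susp (susp_apex R LS b) = pole b.
Proof. exact: susp_rec_apex of_susp_compatible. Qed.

Lemma push_continuous (Z : topologicalType) (phi : Z -> LS) (sg : Z -> R) :
  continuous phi -> continuous sg -> continuous (fun z => push (phi z) (sg z)).
Proof.
move=> cphi csg; apply: normalize_continuous => p; apply: deform_continuous => // q.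
apply: (@cts_comp _ _ _ phi (fun x : LS => \val x q)) cphi.
exact: coord_continuous.
Qed.

Lemma pushB_continuous (Z : topologicalType) (phi : Z -> LS) (sg : Z -> R) :
  continuous phi -> continuous sg -> continuous (fun z => pushB (phi z) (sg z)).
Proof.
move=> cphi csg; apply: normalize_continuous => p; apply: deform_continuous.
  move=> q; apply: (@cts_comp _ _ _ phi (fun x : LS => \val x q)) cphi.
  exact: coord_continuous.
by apply: cts_max; [exact: cts_cst|apply: cts_min => //; exact: cts_cst].
Qed.

Lemma normalize_flip (K1 K2 : complex T) (w w' : T -> R)
    (h : weights K1 w) (h' : weights K2 w') p :
  (forall q, w q = w' (flip q)) -> \val (normalize h) p = \val (normalize h') (flip p).
Proof.
move=> ww' /=; rewrite ww'; congr (_ / _).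
rewrite [RHS](reindex_inj (inv_inj (@flipK V))) /=.
by apply: eq_bigr => q _.
Qed.

Lemma push_nu (x : LS) s : push (Z2_nu x) (- s) = Z2_nu (push x s).
Proof.
apply: realization_ext => p; apply: normalize_flip => q.
exact: (deform_flip E (\val x)).
Qed.

Lemma clamp_pm1N (r : R) : clamp_pm1 (- r) = - clamp_pm1 r.
Proof.
by rewrite /clamp_pm1 oppr_max oppr_min opprK max_minr max_r // (le_trans (lerN10 R)).
Qed.

Lemma pushB_nu (x : LS) s : pushB (Z2_nu x) (- s) = Z2_nu (pushB x s).
Proof.
apply: realization_ext => p; apply: normalize_flip => q.
by rewrite clamp_pm1N; exact: (deform_flip E (\val x)).
Qed.

Lemma pole_nu b : pole (~~ b) = Z2_nu (pole b).
Proof.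
apply: realization_ext => p; apply: normalize_flip => -[v c] /=.
by case: b; case: c.
Qed.

Lemma of_susp_nu z : of_susp (Z2_nu z) = Z2_nu (of_susp z).
Proof.
have [[x [h ->]]|[b ->]] := susp_pointP z.
  by rewrite susp_nu_point !of_susp_point mulrN push_nu.
by rewrite susp_nu_apex !of_susp_apex pole_nu.
Qed.

Lemma of_susp_continuous : continuous of_susp.
Proof.
apply: (@cts_comp _ _ _ (fun z : susp R LS => (z, I0 R)) (fun q : susp R LS * unitI R =>
    susp_rec (fun (x : LS) h => push x (2 * h)) pole q.1)).
  apply: (@susp_rec_continuous R LS KS (fun (x : LS) h _ => push x (2 * h))
    (fun b _ => pole b)).
  - by move=> _; exact: of_susp_compatible.
  - apply: push_continuous; first by do 2 apply: cts_fst; exact: cts_id.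
    apply: ctsM; first exact: cts_cst.
    by apply: cts_snd; apply: cts_fst; exact: cts_id.
  - by move=> b; exact: cts_cst.
by apply: cts_pair; [exact: cts_id|exact: cts_cst].
Qed.

Lemma unitI_compl_ge0 (t : unitI R) : 0 <= 2 * (1 - \val t).
Proof. by have /andP[_ t1] := unitI_valP t; rewrite mulr_ge0 // subr_ge0. Qed.

(** The interval is run through backwards, from the composite to the identity. *)
Definition B0_homotopy (q : KS * unitI R) : KS :=
  normalize (deform_weights0 (realization_weights q.1)
    (imbalance_admissible (realization_weights q.1) (unitI_compl_ge0 q.2))).

Lemma B0_homotopy_continuous : continuous B0_homotopy.
Proof.
have cval p : continuous (fun q : KS * unitI R => \val q.1 p).
  apply: (@cts_comp _ _ _ (fun q : KS * unitI R => q.1) (fun x : KS => \val x p)).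
    exact: coord_continuous.
  by apply: cts_fst; exact: cts_id.
apply: normalize_continuous => p; apply: deform_continuous => //.
apply: ctsM; last exact: imbalance_continuous.
apply: ctsM; first exact: cts_cst.
apply: ctsB; first exact: cts_cst.
by apply: (cts_comp (@unitI_val_continuous R)); apply: cts_snd; exact: cts_id.
Qed.

Lemma B0_homotopic : Z2homotopic R (of_susp \o to_susp) (fun y : KS => y).
Proof.
exists B0_homotopy; split.
- exact: B0_homotopy_continuous.
- move=> t; split.
    apply: (cts_comp B0_homotopy_continuous).
    by apply: cts_pair; [exact: cts_id|exact: cts_cst].
  move=> y; apply: realization_ext => p; apply: normalize_flip => q /=.
  rewrite -[fun _ => _]/(\val y \o @flip V) imbalance_flip mulrN.
  exact: deform_flip.
- move=> y; rewrite /= /B0_homotopy; have [y0 _ _] := realization_weights y.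
  have [[x xy]|[b yb]] := realization_cases y.
    rewrite (to_susp_point xy) of_susp_point.
    apply: (@normalize_scale _ _ _ _ _ _ _ 1); rewrite ?oner_neq0 // => p.
    by rewrite mul1r subr0 mulr1 /= xy.
  have yE := imbalance_one_sided yb.
  rewrite (@to_susp_apex y b); last by rewrite yE; case: (b); rewrite /signed ?opprK ler1n.
  rewrite of_susp_apex.
  (* Outside [B(G)] the imbalance is [-2] or [2]: pushing for a time 4 in absolute
     value ends at the barycenter, with weights 3 before normalization. *)
  have s4 : signed b (2 * (1 - 0) * imbalance (\val y)) = 4.
    by rewrite yE subr0 mulr1; case: (b); rewrite /signed ?mulrN ?opprK -natrM.
  apply: (@normalize_scale _ _ _ _ _ _ _ 3); rewrite ?pnatr_eq0 // => p.
  rewrite (@deform_pole b) // s4 ?ler_nat //; congr (_ * _).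
  by rewrite -[1]/(1%:R) -natrB.
- move=> y; have [y0 _ _] := realization_weights y.
  apply: (@normalize_realization _ _ _ _ _ _ 2) => // p.
  by rewrite subrr mulr0 mul0r deform0.
Qed.

(** At [t = 0] the composite [to_susp \o of_susp], at [t = 1] the identity: the base
    point moves along its path in [B(G)] and the height interpolates linearly. *)
Definition susp_slide (x : LS) (h : R) (t : unitI R) : susp R LS :=
  susp_point (pushB x (2 * (1 - \val t) * h))
    (\val t * h + (1 - \val t) * imbalance (\val (push x (2 * h)))).

(** For a height [h >= 1] both heights that are interpolated are at least 1: the
    second one is 2, as one side is empty after pushing for a time [2 h]. *)
Lemma susp_slide_compatible (t : unitI R) :
  susp_compatible (fun (x : LS) h => susp_slide x h t) (susp_apex R LS).
Proof.
move=> x h; have /andP[t0 t1] := unitI_valP t.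
have t1' : 0 <= 1 - \val t by rewrite subr_ge0.
have conv (a b : R) : 1 <= a -> 1 <= b -> 1 <= \val t * a + (1 - \val t) * b.
  move=> a1 b1; rewrite -[leLHS](_ : \val t * 1 + (1 - \val t) * 1 = 1); last first.
    by rewrite !mulr1 addrC subrK.
  by rewrite lerD // ler_wpM2l.
rewrite /susp_slide; split => h1.
  rewrite susp_point_ge1 // (@imbalance_push x _ true) /signed.
    by apply: conv => //; rewrite ler1n.
  by rewrite (le_trans h1) // ler_peMl ?(le_trans ler01) ?ler1n.
rewrite susp_point_leN1 // (@imbalance_push x _ false) /signed.
  by rewrite -lerN2 opprK opprD -!mulrN opprK; apply: conv; rewrite ?ler1n // lerNr.
have h1' : 1 <= - h by rewrite lerNr.
by rewrite -mulrN (le_trans h1') // ler_peMl ?(le_trans ler01) ?ler1n.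
Qed.

Definition susp_homotopy (q : susp R LS * unitI R) : susp R LS :=
  susp_rec (fun (x : LS) h => susp_slide x h q.2) (susp_apex R LS) q.1.

Lemma susp_homotopy_continuous : continuous susp_homotopy.
Proof.
apply: (@susp_rec_continuous R LS (susp R LS) susp_slide (fun b _ => susp_apex R LS b)).
- exact: susp_slide_compatible.
- have cid := @cts_id (LS * R * unitI R)%type.
  have cx : continuous (fun p : LS * R * unitI R => p.1.1) by do 2 apply: cts_fst.
  have ch : continuous (fun p : LS * R * unitI R => p.1.2) by apply: cts_snd; apply: cts_fst.
  have ct : continuous (fun p : LS * R * unitI R => \val p.2 : R).
    by apply: (cts_comp (@unitI_val_continuous R)); exact: cts_snd.
  have ct' : continuous (fun p : LS * R * unitI R => 1 - \val p.2 : R).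
    by apply: ctsB => //; exact: cts_cst.
  have c2 : continuous (fun _ : LS * R * unitI R => 2 : R) by exact: cts_cst.
  apply: (@cts_comp _ _ _ (fun p : LS * R * unitI R =>
     (pushB p.1.1 (2 * (1 - \val p.2) * p.1.2),
      \val p.2 * p.1.2 + (1 - \val p.2) * imbalance (\val (push p.1.1 (2 * p.1.2)))))
     _ (@susp_point_continuous R LS)).
  apply: cts_pair.
    by apply: pushB_continuous => //; apply: ctsM => //; exact: ctsM.
  apply: ctsD; apply: ctsM => //; apply: imbalance_continuous => p.
  apply: (@cts_comp _ _ _ (fun q : LS * R * unitI R => push q.1.1 (2 * q.1.2))
    (fun y : KS => \val y p)); first exact: coord_continuous.
  by apply: push_continuous => //; exact: ctsM.
- by move=> b; exact: cts_cst.
Qed.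

Lemma susp_homotopy_point (x : LS) (h : R) (t : unitI R) :
  susp_homotopy (susp_point x h, t) = susp_slide x h t.
Proof. exact: susp_rec_point (susp_slide_compatible t). Qed.

Lemma susp_homotopy_apex b (t : unitI R) :
  susp_homotopy (susp_apex R LS b, t) = susp_apex R LS b.
Proof. exact: susp_rec_apex (susp_slide_compatible t). Qed.

Lemma susp_homotopic : Z2homotopic R (to_susp \o of_susp) (fun z : susp R LS => z).
Proof.
exists susp_homotopy; split.
- exact: susp_homotopy_continuous.
- move=> t; split.
    apply: (cts_comp susp_homotopy_continuous).
    by apply: cts_pair; [exact: cts_id|exact: cts_cst].
  move=> z; have [[x [h ->]]|[b ->]] := susp_pointP z.
    rewrite susp_nu_point !susp_homotopy_point /susp_slide susp_nu_point.
    rewrite !mulrN pushB_nu push_nu realization_nu_coord imbalance_flip.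
    by rewrite mulrN -opprD.
  by rewrite susp_nu_apex !susp_homotopy_apex susp_nu_apex.
- move=> z; have [[x [h ->]]|[b ->]] := susp_pointP z.
    rewrite susp_homotopy_point /= of_susp_point /susp_slide.
    rewrite /= subr0 mulr1 mul0r add0r mul1r.
    have [h1|h1] := leP `|2 * h| 1.
      by rewrite (@to_susp_point _ (pushB x (2 * h))) // pushB_push.
    have [b sb] : exists b, 1 <= signed b (2 * h).
      by move: h1; rewrite ltr_normr => /orP[] /ltW; [exists true|exists false].
    have iE := imbalance_push x sb.
    rewrite (@to_susp_apex _ b); last by rewrite iE; case: (b); rewrite /signed ?opprK ler1n.
    rewrite -/(\val (push x (2 * h))) iE; case: (b); rewrite /signed.
      by rewrite susp_point_ge1 // ler1n.
    by rewrite susp_point_leN1 // lerN2 ler1n.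
  rewrite susp_homotopy_apex /= of_susp_apex (@to_susp_apex _ b) //.
  have -> : imbalance (\val (pole b)) = signed b 2.
    apply: imbalance_one_sided; apply: big1 => v _ /=.
    by rewrite eqxx mul0r.
  by case: (b); rewrite /signed ?opprK ler1n.
- move=> z; have [[x [h ->]]|[b ->]] := susp_pointP z.
    by rewrite susp_homotopy_point /susp_slide /= subrr mulr0 !mul0r pushB0 mul1r addr0.
  exact: susp_homotopy_apex.
Qed.

End Equivalence.

Theorem mainTheorem1 (R : realType) (V : finType) (E : rel V)
    (Esym : symmetric E) (Eirr : irreflexive E) (Econn : connected_graph E) :
  Z2homotopy_equivalent R (Z2realization R (B0_complex Esym))
    (susp R (Z2realization R (B_complex Esym))).
Proof.
have [V0 _] := Econn.
exists (@to_susp R V E Esym); split.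
  by split; [exact: to_susp_continuous|exact: to_susp_nu].
exists (of_susp Eirr V0); split.
- by split; [exact: of_susp_continuous|exact: of_susp_nu].
- exact: B0_homotopic.
- exact: susp_homotopic.
Qed.
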